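(* Let $Z=\mathbb R^{2N}$ and $\mu\in\mathcal M(Z\times Z)$. Assume: (i) $\mu=L\,\mathcal L^{2N}\times\mathcal L^{2N}$ with $L\in L^1_{\rm loc}(Z\times Z)$ non-negative. (ii) There exists a function $\hat L:Z\to\mathbb R$ such that $\hat L(\xi/\sqrt2)=\lim_{\lambda\to+\infty}L(S_\lambda(\xi,\eta))$ for $\mathcal L^{4N}$-a.e. $(\xi,\eta)\in Z\times Z$. (iii) There are $g_0\in L^1(Z\times Z)$, $\lambda_0>0$ and $\beta_0>0$ such that $\bar w_{\beta_0}(\eta)L(S_\lambda(\xi,\eta))\le g_0(\xi,\eta)$ for $\mathcal L^{4N}$-a.e. $(\xi,\eta)\in Z\times Z$ and all $\lambda\ge\lambda_0$. Let $(\mu_h)_{h\in\mathbb N}$ be a sequence of measures in $\mathcal M(Z\times Z)$. Assume additionally: (iv) For every $h\in\mathbb N$ there is a Borel map $T_h:Z\times Z\to Z\times Z$ such that $\mu_h=T_h\#\mu$. (v) There is a sequence $(\beta_h)$ of positive numbers diverging to $+\infty$ such that, setting $\lambda_h:=\sqrt{\beta_h/\beta_0}$ with $\beta_0$ as in (iii), for every $(\xi,\eta)\in Z\times Z$ one has $$\lim_{h\to\infty}T_h\circ S_{\lambda_h}(\xi,\eta)=\Big(\frac{\xi}{\sqrt2},\frac{\xi}{\sqrt2}\Big)\qquad\text{and}\qquad\lim_{h\to\infty}\eta_h'(\xi,\eta)=\eta,$$ where $(\xi_h'(\xi,\eta),\eta_h'(\xi,\eta)):=S_{\lambda_h}^{-1}\circ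 T_h\circ S_{\lambda_h}(\xi,\eta)$. (vi) There are a function $g\in L^1(Z\times Z)$ and $h_0\in\mathbb N$ such that for every $h\ge h_0$ and every $(\xi,\eta)\in Z\times Z$ $$\big[\bar w_{\beta_0}(\eta)+\bar w_{\beta_0}(\eta_h'(\xi,\eta))\big]\,L(S_{\lambda_h}(\xi,\eta))\le g(\xi,\eta).$$ Then $$\mathop{w\text{-}\lim}_{h\to\infty}\,(\mu_{h,\beta_h}-\mu_{\beta_h})=0$$ in $\mathcal M_b(Z\times Z)$, i.e. $\mu_{h,\beta_h}(f)-\mu_{\beta_h}(f)\to0$ as $h\to\infty$ for all $f\in C_b(Z\times Z)$.
   Context: $N\ge1$ is an integer; $Z=\mathbb R^{2N}$ is endowed with a scalar product, with corresponding norm $\|\cdot\|$. For a metric space $X$, $\mathcal M(X)$ is the set of (positive) Radon measures on $X$ and $\mathcal M_b(X)=\{\mu\in\mathcal M(X):\mu(X)<\infty\}$; $\mu(f):=\int_X f\,d\mu$; $C_b(X)$ is the set of bounded continuous real functions on $X$. The weak limit statement is understood with $\mu_{h,\beta_h},\mu_{\beta_h}\in\mathcal M_b(Z\times Z)$ for all sufficiently large $h$. $T\#\mu$ denotes the push-forward, $(T\#\mu)(A)=\mu(T^{-1}(A))$ for Borel $A$. $L$ is regarded as a fixed, pointwise defined function. For a measure $\mu\in\mathcal M(Z\times Z)$ and $\beta>0$, the thermalized measure is $$\mu_\beta:=w_\beta\,\mu,\quad w_\beta(y,z):=B_\beta^{-1}e^{-\beta\|y-z\|^2},\quad B_\beta:=\int_Z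 e^{-\beta\|\xi\|^2}\,d\xi ,$$ and $\mu_{h,\beta}:=w_\beta\,\mu_h$. For $\lambda>0$, $S_\lambda:Z\times Z\to Z\times Z$ is the invertible linear map $$S_\lambda(\xi,\eta):=\Big(\frac{\xi+\eta/\lambda}{\sqrt2},\frac{\xi-\eta/\lambda}{\sqrt2}\Big),\qquad S_\lambda^{-1}(y,z)=\Big(\frac{y+z}{\sqrt2},\lambda\frac{y-z}{\sqrt2}\Big),$$ and $\bar w_{\beta_0}(\eta):=B_{\beta_0}^{-1}e^{-2\beta_0\|\eta\|^2}$. *)

(* Defs.v *)
From HB Require Import structures.
From mathcomp Require Import all_boot all_order all_algebra sesquilinear.
From mathcomp Require Import ring lra.
From mathcomp Require Import all_classical all_reals all_analysis.
From mathcomp Require Import measurable_realfun.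

Set Implicit Arguments.
Unset Strict Implicit.
Unset Printing Implicit Defensive.

Import Order.TTheory GRing.Theory Num.Theory numFieldNormedType.Exports.

Local Open Scope classical_set_scope.
Local Open Scope ring_scope.

Section borel_matrix.
Variables (R : realType) (m n : nat).

HB.instance Definition _ :=
  @isMeasurable.Build (sigma_display (@open 'M[R]_(m, n)))
    'M[R]_(m, n) <<s @open 'M[R]_(m, n) >>
    (@sigma_algebra0 _ setT _) (@sigma_algebraC _ _)
    (@sigma_algebra_bigcup _ setT _).

End borel_matrix.


Section second_countable_lemmas.
Variable R : realType.

Lemma dense_second_countable (T : pseudoMetricType R) (I : countType)
    (q : I -> T) :
  (forall x (e : R), 0 < e -> exists i, ball x e (q i)) ->
  @second_countable T.
Proof.
move=> qP; pose B (ik : I * nat) : set T := (ball (q ik.1) ik.2.+1%:R^-1)°.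
exists (range B); first exact: (sub_countable (card_image_le _ _) (countableP _)).
split=> [_ [ik _ <-]|x A]; first exact: open_interior.
rewrite -nbhs_ballE => -[e /= e0 eA].
have e20 : 0 < e / 2 by rewrite divr_gt0.
have [k ke] : exists k : nat, k.+1%:R^-1 < e / 2.
  have [k /= _ /(_ k (leqnn k))] := near_infty_natSinv_lt (PosNum e20).
  by move=> kP; exists k.
set r := k.+1%:R^-1 : R.
have r0 : 0 < r by rewrite invr_gt0.
have r20 : 0 < r / 2 by rewrite divr_gt0.
have [i xi] := qP x _ r20.
exists (B (i, k)); last first.
  move=> y /interior_subset /= By; apply: eA.
  apply: (@le_ball _ _ _ (r / 2 + r)); last exact: ball_triangle xi By.
  by rewrite -/r in ke; lra.
split; first by exists (i, k).
rewrite /B /interior /= -nbhs_ballE; exists (r / 2) => //= y xy.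
rewrite -/r (splitr r); apply: ball_triangle xy; exact: ball_sym.
Qed.

Lemma rat_ball (x e : R) : 0 < e -> exists q : rat, ball x e (ratr q : R).
Proof.
move=> e0.
have [q] : exists q : rat, ratr q \in `]x, (x + e)[.
  by apply: rat_in_itvoo; rewrite ltrDl.
rewrite in_itv/= => /andP[xq qe]; exists q.
by rewrite /ball/= ltr_norml; apply/andP; split; lra.
Qed.

Lemma second_countable_R : @second_countable R.
Proof. exact: (dense_second_countable rat_ball). Qed.

Lemma second_countable_mx m n : @second_countable 'M[R]_(m, n).
Proof.
apply: (@dense_second_countable 'M[R]_(m, n) 'M[rat]_(m, n)
  (fun q => map_mx ratr q)) => x e e0.
have qP i j : exists q : rat, ball (x i j) e (ratr q : R) by exact: rat_ball.
exists (\matrix_(i, j) sval (cid (qP i j))); split => // i j.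
by rewrite !mxE; case: cid.
Qed.

Lemma open_prod_bigcup (T1 T2 : topologicalType) (U : set (T1 * T2)) :
  @second_countable T1 -> @second_countable T2 -> open U ->
  exists F : nat -> set T1 * set T2,
    (forall k, open (F k).1 /\ open (F k).2) /\
    U = \bigcup_k ((F k).1 `*` (F k).2).
Proof.
move=> [B1 cB1 [oB1 bB1]] [B2 cB2 [oB2 bB2]] oU.
pose C := (B1 `*` B2) `&` [set AB | AB.1 `*` AB.2 `<=` U].
have cC : countable C by apply: sub_countable (subset_card_le _) (countableX cB1 cB2) => ? [].
have CU p : U p -> exists2 AB, C AB & AB.1 p.1 /\ AB.2 p.2.
  move=> Up; have /= : nbhs p U by exact: open_nbhs_nbhs.
  case: p Up => x y Up [[P Q] /= [Px Qy] PQU].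
  have [A [BA Ax] AP] := bB1 x _ Px.
  have [A' [BA' Ay] AQ] := bB2 y _ Qy.
  exists (A, A') => //; split => //= -[a b] [/= Aa Ab]; apply: PQU.
  by split; [exact: AP|exact: AQ].
have [C0|/set0P C0] := eqVneq C set0.
  exists (fun=> (set0, set0)); split; first by move=> k; split; exact: open0.
  apply/seteqP; split => [p /CU[AB]|p [k _ []]]//; by rewrite C0.
case/pfcard_geP: cC => [C0'|[f]]; first by move/set0P: C0; rewrite C0' eqxx.
exists f; split.
  by move=> k; have [[/oB1 ? /oB2 ?] _] : C (f k) by exact: (@funS _ _ _ _ f).
apply/seteqP; split => [p /CU[AB CAB ABp]|p [k _ fkp]].
  have [k _ fk] := @surj _ _ _ _ f _ CAB.
  by exists k => //; rewrite fk.
by have [_] : C (f k) by [exact: (@funS _ _ _ _ f)]; apply.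
Qed.

End second_countable_lemmas.

Section borel_product.

(* By second countability, the product sigma-algebra carried by a product of
   two such spaces is its Borel sigma-algebra. *)
Lemma measurable_prod_borel (R : realType) (m n p q : nat) :
  @measurable _ ('M[R]_(m, n) * 'M[R]_(p, q))%type = <<s open >>.
Proof.
apply/seteqP; split; last first.
  apply: smallest_sub; first exact: sigma_algebra_measurable.
  move=> U /(open_prod_bigcup (@second_countable_mx _ _ _)
    (@second_countable_mx _ _ _))[F [oF ->]].
  apply: bigcup_measurable => k _; have [oF1 oF2] := oF k.
  by apply: measurableX; exact: sub_sigma_algebra.
apply: smallest_sub; first exact: smallest_sigma_algebra.
have H (T1 : topologicalType) (T2 : ptopologicalType) (f : T1 -> T2) :
    continuous f -> preimage_set_system setT f <<s @open T2 >>
    `<=` <<s @open T1 >>.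
  move=> cf; rewrite -g_sigma_preimageE.
  apply: smallest_sub; first exact: smallest_sigma_algebra.
  move=> _ [U oU <-]; rewrite setTI; apply: sub_sigma_algebra.
  by apply: open_comp => // x _; exact: cf.
move=> A [] mA.
- by apply: (H _ 'M[R]_(m, n) fst _ A mA) => x; exact: cvg_fst.
- by apply: (H _ 'M[R]_(p, q) snd _ A mA) => x; exact: cvg_snd.
Qed.

Lemma open_measurable_prod (R : realType) (m n p q : nat)
    (U : set ('M[R]_(m, n) * 'M[R]_(p, q))) : open U -> measurable U.
Proof. by move=> oU; rewrite measurable_prod_borel; exact: sub_sigma_algebra. Qed.

Lemma continuous_measurable_prod (R : realType) (m n p q : nat)
    (f : 'M[R]_(m, n) * 'M[R]_(p, q) -> R) :
  continuous f -> measurable_fun setT f.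
Proof.
move=> cf; apply: (measurability _ (RGenOpens.measurableE R)).
move=> _ [_ [a [b ->] <-]]; rewrite setTI; apply: open_measurable_prod.
by apply: open_comp; [move=> x _; exact: cf|exact: interval_open].
Qed.

End borel_product.

Lemma sigma_finite_product d1 d2 (T1 : measurableType d1)
    (T2 : measurableType d2) (R : realType)
    (m1 : {sigma_finite_measure set T1 -> \bar R})
    (m2 : {sigma_finite_measure set T2 -> \bar R}) :
  sigma_finite setT (m1 \x m2)%E.
Proof.
have /sigma_finiteP[F [TF ndF Foo]] := sigma_finiteT m1.
have /sigma_finiteP[G [TG ndG Goo]] := sigma_finiteT m2.
exists (fun k => F k `*` G k).
  rewrite -setXTT TF TG; apply/seteqP; split => [[x y]|[x y]].
    move=> [/= [k _ Fkx] [l _ Gly]]; exists (maxn k l) => //; split.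
    - by move: x Fkx; exact/subsetPset/ndF/leq_maxl.
    - by move: y Gly; exact/subsetPset/ndG/leq_maxr.
  by move=> [k _ []/= ? ?]; split; exists k.
move=> k; have [? ?] := Foo k; have [? ?] := Goo k.
split; first exact: measurableX.
by rewrite product_measure1E// lte_mul_pinfty// ge0_fin_numE.
Qed.

Section lebesgue_row.
Variable R : realType.

Definition cons_rV n (p : R * 'rV[R]_n) : 'rV[R]_n.+1 :=
  row_mx (const_mx p.1 : 'rV_1) p.2.

Lemma cons_rV0 n (p : R * 'rV[R]_n) : cons_rV p 0 ord0 = p.1.
Proof.
have -> : @ord0 n = lshift n (@ord0 0) by exact: val_inj.
by rewrite [LHS](row_mxEl (const_mx p.1 : 'rV_1) p.2) mxE.
Qed.

Lemma cons_rVS n (p : R * 'rV[R]_n) (i : 'I_n) :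
  cons_rV p 0 (lift ord0 i) = p.2 0 i.
Proof.
have -> : lift ord0 i = rshift 1 i by exact: val_inj.
by rewrite [LHS](row_mxEr (const_mx p.1 : 'rV_1) p.2).
Qed.

Definition uncons_rV n (x : 'rV[R]_n.+1) : R * 'rV[R]_n :=
  (x 0 ord0, \row_i x 0 (lift ord0 i)).

Lemma cons_rVK n : cancel (@cons_rV n) (@uncons_rV n).
Proof.
move=> [x y]; rewrite /uncons_rV cons_rV0; congr pair.
by apply/rowP => i; rewrite mxE cons_rVS.
Qed.

Lemma continuous_cons_rV n : continuous (@cons_rV n).
Proof.
move=> p A [P /= pP PA].
have [Q Qp QP] : exists2 Q : set 'rV[R]_n, nbhs p.2 Q &
    forall y, Q y -> forall i, P 0 (lift ord0 i) (y 0 i).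
  exists [set y | forall i, P 0 (lift ord0 i) (y 0 i)] => //.
  exists (fun _ i => P 0 (lift ord0 i)) => //= k i.
  by rewrite (ord1 k); have := pP 0 (lift ord0 i); rewrite cons_rVS.
exists (P 0 ord0, Q); first by split => //=; rewrite -[p.1]cons_rV0; exact: pP.
move=> q [/= q1 q2]; apply: PA => i j; rewrite (ord1 i).
case: (unliftP ord0 j) => [k ->|->]; first by rewrite cons_rVS; exact: QP.
by rewrite cons_rV0.
Qed.

Lemma measurable_cons_rV n :
  measurable_fun [set: measurableTypeR R * 'rV[R]_n] (@cons_rV n).
Proof.
apply: (measurability (@open 'rV[R]_n.+1)) => // _ [U oU <-]; rewrite setTI.
have : open (@cons_rV n @^-1` U).
  by apply: open_comp => // x _; exact: continuous_cons_rV.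
move=> /(open_prod_bigcup (second_countable_R R)
  (@second_countable_mx _ _ _))[F [oF ->]].
apply: bigcup_measurable => k _; have [oF1 oF2] := oF k.
by apply: measurableX; [exact: open_measurable|exact: sub_sigma_algebra].
Qed.

Lemma measurable_uncons_rV n : measurable_fun setT
  (@uncons_rV n : 'rV[R]_n.+1 -> measurableTypeR R * 'rV[R]_n).
Proof.
apply: measurable_fun_pair.
  apply: (measurability _ (RGenOpens.measurableE R)).
  move=> _ [_ [a [b ->] <-]]; rewrite setTI; apply: sub_sigma_algebra.
  apply: open_comp; last exact: interval_open.
  by move=> x _; exact: coord_continuous.
apply: (measurability (@open 'rV[R]_n)) => // _ [U oU <-]; rewrite setTI.
apply: sub_sigma_algebra; apply: open_comp => // x _ A [P /= xP PA].
exists (fun _ j => if unlift ord0 j is Some k then P 0 k else setT) => /=.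
  move=> i j; case: unliftP => [k jk|_]; last exact: filterT.
  by have := xP 0 k; rewrite mxE jk (ord1 i).
move=> y /= yP; apply: PA => i j; rewrite mxE (ord1 i).
by have := yP 0 (lift ord0 j); rewrite liftK.
Qed.

Section step.
Variables (n : nat) (mu : {sigma_finite_measure set 'rV[R]_n -> \bar R}).

Definition lebesgue_cons : set 'rV[R]_n.+1 -> \bar R :=
  pushforward (lebesgue_measure \x mu)%E (@cons_rV n).


Let lebesgue_cons0 : lebesgue_cons set0 = 0%E.
Proof. by rewrite /lebesgue_cons /pushforward preimage_set0 measure0. Qed.

Let lebesgue_cons_ge0 A : (0 <= lebesgue_cons A)%E.
Proof. exact: (measure_ge0 (lebesgue_measure \x mu)%E). Qed.

Let lebesgue_cons_sigma_additive : semi_sigma_additive lebesgue_cons.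
Proof.
move=> F mF tF mUF; rewrite /lebesgue_cons /pushforward preimage_bigcup.
have mF' k : measurable (@cons_rV n @^-1` F k).
  by rewrite -[X in measurable X]setTI; exact: measurable_cons_rV.
apply: measure_semi_sigma_additive => //.
- apply/trivIsetP => /= i j _ _ ij; rewrite -preimage_setI.
  by move/trivIsetP : tF => /(_ _ _ _ _ ij) ->//; rewrite preimage_set0.
- by apply: bigcup_measurable => k _; exact: mF'.
Qed.

HB.instance Definition _ := isMeasure.Build _ _ _ lebesgue_cons
  lebesgue_cons0 lebesgue_cons_ge0 lebesgue_cons_sigma_additive.

Let lebesgue_cons_sigma_finite : sigma_finite setT lebesgue_cons.
Proof.
have [F FT Foo] := sigma_finite_product lebesgue_measure mu.
exists (fun k => @uncons_rV n @^-1` F k).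
  by rewrite -preimage_bigcup -FT.
move=> k; have [mFk Fkoo] := Foo k; split.
  by rewrite -[X in measurable X]setTI; exact: measurable_uncons_rV.
rewrite /lebesgue_cons /pushforward -comp_preimage.
by rewrite (_ : _ \o _ = id) ?preimage_id//; apply/funext => p; exact: cons_rVK.
Qed.

HB.instance Definition _ := Measure_isSigmaFinite.Build _ _ _ lebesgue_cons
  lebesgue_cons_sigma_finite.

End step.

Fixpoint lebesgue_rV n : {sigma_finite_measure set 'rV[R]_n -> \bar R} :=
  match n with
  | 0 => @dirac _ 'rV[R]_0 0 R
  | n'.+1 => lebesgue_cons (lebesgue_rV n')
  end.

Lemma closed_box n (a b : 'rV[R]_n) :
  closed [set x : 'rV[R]_n | forall i, a 0 i <= x 0 i <= b 0 i].
Proof.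
rewrite (_ : mkset _ =
    \bigcap_i (fun x : 'rV[R]_n => x 0 i) @^-1` `[a 0 i, b 0 i]); last first.
  apply/seteqP; split => [x xab i _|x xab i]; first by rewrite /= in_itv/= xab.
  by have := xab i I; rewrite /= in_itv.
apply: closed_bigI => i _; apply: closed_comp; last exact: interval_closed.
by move=> x _; exact: coord_continuous.
Qed.

Lemma lebesgue_rV_box n (a b : 'rV[R]_n) : (forall i, a 0 i <= b 0 i) ->
  lebesgue_rV n [set x : 'rV[R]_n | forall i, a 0 i <= x 0 i <= b 0 i] =
  (\prod_(i < n) (b 0 i - a 0 i))%:E.
Proof.
elim: n a b => [|n IH] a b ab.
  by rewrite big_ord0 /= diracE mem_set// => -[].
rewrite big_ord_recl /= /lebesgue_cons /pushforward.
rewrite (_ : _ @^-1` _ = (`[a 0 ord0, b 0 ord0] : set (measurableTypeR R)) `*`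
    [set y : 'rV[R]_n | forall i, (uncons_rV a).2 0 i <= y 0 i <= (uncons_rV b).2 0 i]).
  rewrite product_measure1E//; last first.
    rewrite -[X in measurable X]setCK; apply: measurableC; apply: sub_sigma_algebra.
    by apply: closed_openC; exact: closed_box.
  rewrite [X in (X * _)%E](lebesgue_measure_itv `[a 0 ord0, b 0 ord0]) /=.
  rewrite IH; last by move=> i; rewrite !mxE.
  rewrite lte_fin EFinM; congr (_ * _)%E.
    rewrite lt_neqAle ab andbT; case: eqVneq => [->|//]; by rewrite subrr.
  by congr EFin; apply: eq_bigr => i _; rewrite !mxE.
apply/seteqP; split => [[x y]/= xy|[x y]/= [xab yab] i].
  split; first by have := xy ord0; rewrite cons_rV0 in_itv.
  by move=> i; have := xy (lift ord0 i); rewrite cons_rVS !mxE.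
case: (unliftP ord0 i) => [k ->|->]; last by rewrite cons_rV0; rewrite in_itv in xab.
by have := yab k; rewrite cons_rVS !mxE.
Qed.

End lebesgue_row.

Section lower_integral.
Context d (T : measurableType d) (R : realType).
Variable mu : {measure set T -> \bar R}.
Import HBNNSimple.
Local Open Scope ereal_scope.

(* No measurability is required: the integral of a non-negative function is a
   supremum over the simple functions below it. *)
Lemma ge0_ae_eq_integral_sup (D : set T) (f g : T -> \bar R) :
  (forall x, D x -> 0 <= f x) -> (forall x, D x -> 0 <= g x) ->
  {ae mu, forall x, D x -> f x = g x} ->
  \int[mu]_(x in D) f x = \int[mu]_(x in D) g x.
Proof.
have le f' g' : (forall x, D x -> 0 <= f' x) -> (forall x, D x -> 0 <= g' x) ->
    {ae mu, forall x, D x -> f' x = g' x} ->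
    \int[mu]_(x in D) f' x <= \int[mu]_(x in D) g' x.
  move=> f0 g0 [N [mN N0 fgN]]; rewrite ge0_integralE// [leRHS]ge0_integralE//.
  apply: ge_ereal_sup => _ [h /= hf <-].
  have mNC := measurableC mN.
  pose h' := mul_nnsfun h (indic_nnsfun R mNC).
  have -> : sintegral mu h = sintegral mu h'.
    rewrite -!integralT_nnsfun; apply: ge0_ae_eq_integral => //.
    - exact/measurable_EFinP.
    - exact/measurable_EFinP.
    - by move=> x _; rewrite lee_fin.
    - by move=> x _; rewrite lee_fin.
    exists N; split => // x /= xh; apply: contrapT => Nx; apply: xh => _.
    by rewrite /= mindicE mem_set ?mulr1.
  apply: ereal_sup_ubound; exists h' => // x.
  rewrite /= mindicE; have [Nx|Nx] := pselect (N x).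
    rewrite memNset ?mulr0; last by move=> /(_ Nx).
    by rewrite patchE; case: ifPn => // /set_mem; exact: g0.
  rewrite mem_set// mulr1 (le_trans (hf x))// !patchE; case: ifPn => // /set_mem Dx.
  suff -> : f' x = g' x by [].
  by apply: contrapT => fg; apply: Nx; apply: fgN => /(_ Dx).
move=> f0 g0 fg; apply/eqP; rewrite eq_le !le//.
by move: fg; apply: filterS => x fg Dx; rewrite fg.
Qed.

End lower_integral.

Section scalar_product.
Variables (R : realType) (n : nat) (dot : {dot 'rV[R]_n for idfun}).

(* All norms on 'rV[R]_n being equivalent, the library's (sup norm) topology of
   'rV[R]_n is the one induced by this norm. *)
Definition norm_of (x : 'rV[R]_n) : R := Num.sqrt (dot x x).

Lemma dot_ge0 x : 0 <= dot x x.
Proof.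
have [->|x0] := eqVneq x 0; first by rewrite linear0r.
exact/ltW/neq0_dnorm_gt0.
Qed.

Lemma dot_expand x :
  dot x x = \sum_i \sum_j x 0 i * x 0 j * dot (delta_mx 0 i) (delta_mx 0 j).
Proof.
rewrite [in LHS](row_sum_delta x) linear_sumlz; apply: eq_bigr => i _.
rewrite linear_sumr; apply: eq_bigr => j _.
by rewrite linearZl_LR linearZr_LR /= mulrA.
Qed.

Lemma continuous_norm_of : continuous norm_of.
Proof.
move=> x; apply: (@continuous_comp _ _ _ (fun y => dot y y) Num.sqrt);
  last exact: sqrt_continuous.
rewrite (_ : (fun y => dot y y) = fun y =>
  \sum_i \sum_j y 0 i * y 0 j * dot (delta_mx 0 i) (delta_mx 0 j)); last first.
  by apply/funext => y; exact: dot_expand.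
have FF := @nbhs_filter _ x.
apply: cvg_big => [|i _]; first exact: add_continuous.
apply: cvg_big => [|j _]; first exact: add_continuous.
apply: (@cvgMr_tmp _ _ _ FF); apply: (@cvgM _ _ _ FF); exact: coord_continuous.
Qed.

End scalar_product.

Section thermalization.
Variables (R : realType) (n : nat) (dot : {dot 'rV[R]_n for idfun}).
Local Notation Z := 'rV[R]_n.

Definition gauss_mass (beta : R) : R :=
  \int[lebesgue_rV R n]_xi expR (- beta * norm_of dot xi ^+ 2).

Definition thermal_weight (beta : R) (p : Z * Z) : R :=
  (gauss_mass beta)^-1 * expR (- beta * norm_of dot (p.1 - p.2) ^+ 2).

Definition thermal_weight_bar (beta : R) (eta : Z) : R :=
  (gauss_mass beta)^-1 * expR (- (2 * beta) * norm_of dot eta ^+ 2).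

Lemma gauss_mass_ge0 beta : 0 <= gauss_mass beta.
Proof. by apply: Rintegral_ge0 => x _; exact: expR_ge0. Qed.

Lemma thermal_weight_ge0 beta p : 0 <= thermal_weight beta p.
Proof. by rewrite mulr_ge0 ?invr_ge0 ?gauss_mass_ge0 ?expR_ge0. Qed.

Lemma continuous_thermal_weight beta : continuous (thermal_weight beta).
Proof.
have cB : continuous (fun q : Z * Z => q.1 - q.2).
  by move=> q; apply: cvgB; [exact: cvg_fst|exact: cvg_snd].
have cN : continuous (fun q : Z * Z => norm_of dot (q.1 - q.2)).
  move=> q; apply: (@continuous_comp (Z * Z)%type Z R _ (norm_of dot) q (cB q)).
  exact: continuous_norm_of.
have cE : continuous (fun q : Z * Z => - beta * norm_of dot (q.1 - q.2) ^+ 2).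
  move=> q; have FF := @nbhs_filter _ q.
  apply: (@cvgMl_tmp _ _ _ FF).
  apply: (@continuous_comp (Z * Z)%type R R _ (fun x => x ^+ 2) q (cN q)).
  exact: exprn_continuous.
move=> p; apply: (@cvgMl_tmp _ _ _ (@nbhs_filter _ p)).
apply: (@continuous_comp (Z * Z)%type R R _ expR p (cE p)).
exact: continuous_expR.
Qed.

Lemma measurable_thermal_weight beta :
  measurable_fun setT (thermal_weight beta).
Proof.
by apply: continuous_measurable_prod; exact: continuous_thermal_weight.
Qed.

Section thermalized.
Variables (beta : R) (mu : {measure set (Z * Z) -> \bar R}).

Definition thermalized (A : set (Z * Z)) : \bar R :=
  (\int[mu]_(p in A) (thermal_weight beta p)%:E)%E.

Let thermalized0 : thermalized set0 = 0%E.
Proof. exact: integral_set0. Qed.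

Let thermalized_ge0 A : (0 <= thermalized A)%E.
Proof. by apply: integral_ge0 => p _; rewrite lee_fin thermal_weight_ge0. Qed.

Let thermalized_sigma_additive : semi_sigma_additive thermalized.
Proof.
move=> F mF tF mUF; rewrite /thermalized ge0_integral_bigcup//=.
- by apply: is_cvg_ereal_nneg_natsum_cond => k _ _; exact: thermalized_ge0.
- apply/measurable_EFinP; apply: measurable_funS (measurable_thermal_weight _) => //.
- by move=> p _; rewrite lee_fin thermal_weight_ge0.
Qed.

HB.instance Definition _ := isMeasure.Build _ _ _ thermalized
  thermalized0 thermalized_ge0 thermalized_sigma_additive.

End thermalized.

End thermalization.

Section rescaling.
Variables (R : realType) (n : nat).
Local Notation Z := 'rV[R]_n.

Definition S_ (lambda : R) (p : Z * Z) : Z * Z :=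
  ((Num.sqrt 2)^-1 *: (p.1 + lambda^-1 *: p.2),
   (Num.sqrt 2)^-1 *: (p.1 - lambda^-1 *: p.2)).

Definition S_inv (lambda : R) (p : Z * Z) : Z * Z :=
  ((Num.sqrt 2)^-1 *: (p.1 + p.2),
   lambda *: ((Num.sqrt 2)^-1 *: (p.1 - p.2))).

Let isqrt2 : (Num.sqrt 2)^-1 * (Num.sqrt 2)^-1 = 2^-1 :> R.
Proof. by rewrite -invfM -expr2 sqr_sqrtr. Qed.

Lemma S_K lambda : 0 < lambda -> cancel (S_ lambda) (S_inv lambda).
Proof.
move=> l0 [x y]; have ln0 : lambda != 0 by rewrite gt_eqF.
rewrite /S_inv /S_ /=.
rewrite -scalerDr -scalerBr !scalerA isqrt2; congr pair; apply/rowP => i.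
  by rewrite !mxE; field.
by rewrite !mxE -mulrA isqrt2; field.
Qed.

Lemma S_invK lambda : 0 < lambda -> cancel (S_inv lambda) (S_ lambda).
Proof.
move=> l0 [x y]; have ln0 : lambda != 0 by rewrite gt_eqF.
rewrite /S_inv /S_ /= scalerA mulVf// scale1r.
rewrite -scalerDr -scalerBr !scalerA isqrt2.
by congr pair; apply/rowP => i; rewrite !mxE; field.
Qed.

End rescaling.

Section function_and_measure_spaces.
Variables (R : realType) (n : nat).
Local Notation Z := 'rV[R]_n.
Local Notation leb := (lebesgue_rV R n).

(* Finiteness on compact sets is local finiteness here, the space being locally
   compact. *)
Definition radon (mu : {measure set (Z * Z) -> \bar R}) :=
  (forall K : set (Z * Z), compact K -> (mu K < +oo)%E) /\
  (forall A : set (Z * Z), measurable A ->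
    mu A = ereal_sup [set mu K | K in [set K | compact K /\ K `<=` A]]).

Definition bounded_radon (mu : {measure set (Z * Z) -> \bar R}) :=
  radon mu /\ (mu setT < +oo)%E.

(* Elements of $L^1$ and $L^1_{loc}$ are Lebesgue measurable functions, i.e.,
   functions that agree almost everywhere with a Borel function. *)
Definition in_L1 (f : Z * Z -> R) := exists2 f' : Z * Z -> R,
  (leb \x leb)%E.-integrable setT (EFin \o f') &
  {ae (leb \x leb)%E, forall p, f p = f' p}.

Definition in_L1loc (f : Z * Z -> R) := exists f' : Z * Z -> R,
  [/\ measurable_fun setT f',
      forall K : set (Z * Z), compact K ->
        (leb \x leb)%E.-integrable K (EFin \o f') &
      {ae (leb \x leb)%E, forall p, f p = f' p}].

End function_and_measure_spaces.

(* Main.v *)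
(* In the coordinates p = S_lambda (xi, eta), with lambda^2 = beta / beta_0, the
   Jacobian lambda^(-2N) of S_lambda and the normalization
   B_beta = lambda^(-2N) B_(beta_0) cancel, so that the two thermalized integrals
   of f become
     \int wbar(eta'_h) f(T_h S p) L(S p) dp  and  \int wbar(eta) f(S p) L(S p) dp.
   Both integrands converge almost everywhere to the same limit
   wbar(eta) f(xi / sqrt 2, xi / sqrt 2) Lhat(xi / sqrt 2), and (vi) bounds their
   difference by sup |f| g, so dominated convergence applies.  The same bound
   makes the thermalized measures finite; inner regularity passes from mu to
   w_beta mu because w_beta is bounded. *)
Require Import Defs.
From HB Require Import structures.
From mathcomp Require Import all_boot all_order all_algebra sesquilinear.
From mathcomp Require Import all_classical all_reals all_analysis.
From mathcomp Require Import ring lra.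
From mathcomp Require Import measurable_realfun.

Set Implicit Arguments.
Unset Strict Implicit.
Unset Printing Implicit Defensive.

Import Order.TTheory GRing.Theory Num.Theory numFieldNormedType.Exports.

Local Open Scope classical_set_scope.
Local Open Scope ring_scope.

(** * Integration against the image of a weighted measure *)

Section weighted_image_measure.
Local Open Scope ereal_scope.
Context d1 d2 (T1 : measurableType d1) (T2 : measurableType d2) (R : realType).
Variables (nu : {measure set T2 -> \bar R}) (m : {measure set T1 -> \bar R}).
Variables (w : T1 -> R) (phi : T1 -> T2).
Hypotheses (mw : measurable_fun setT w) (w0 : forall x, (0 <= w x)%R).
Hypothesis mphi : measurable_fun setT phi.
Hypothesis nuE : forall A, measurable A ->
  nu A = \int[m]_x ((w x)%:E * (\1_A (phi x))%:E).

Import HBNNSimple.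

(** Hypothesis [nuE] makes [nu] the push-forward by [phi] of the measure with density [w] with
    respect to [m]. The formula passes from indicators to simple functions by linearity and to [F]
    by monotone convergence. The case [w = 1] covers push-forwards and the case [phi = id] covers
    densities, so this one lemma serves every later substitution. *)
Lemma ge0_integral_weighted_image (F : T2 -> \bar R) :
  measurable_fun setT F -> (forall y, 0 <= F y) ->
  \int[nu]_y F y = \int[m]_x ((w x)%:E * F (phi x)).
Proof.
move=> mF F0; pose h := nnsfun_approx measurableT mF.
have mwE : measurable_fun setT (EFin \o w) by exact/measurable_EFinP.
have FE y : F y = limn (fun n => (h n y)%:E).
  by apply/esym/cvg_lim => //; apply: cvg_nnsfun_approx.
have wFE x : (w x)%:E * F (phi x) = limn (fun n => (w x)%:E * (h n (phi x))%:E).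
  apply/esym/cvg_lim => //; apply: cvgeZl => //.
  exact: cvg_nnsfun_approx.
under eq_integral do rewrite FE.
under [RHS]eq_integral do rewrite wFE.
have mh n : measurable_fun setT (fun x => (h n (phi x))%:E).
  by apply/measurable_EFinP; exact: measurableT_comp.
rewrite monotone_convergence//; last 3 first.
- by move=> n; exact/measurable_EFinP.
- by move=> n y _; rewrite lee_fin.
- by move=> y _ a b ab; rewrite lee_fin; exact/lefP/nd_nnsfun_approx.
rewrite monotone_convergence//; last 3 first.
- by move=> n; exact: emeasurable_funM.
- by move=> n x _; rewrite mule_ge0 ?lee_fin.
- move=> x _ a b ab; rewrite lee_wpmul2l ?lee_fin//.
  exact/lefP/nd_nnsfun_approx.
congr (limn _); apply/funext => n.
have m1 y : measurable (h n @^-1` [set y]) by exact: measurable_sfunP.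
have mi y : measurable_fun setT (fun x => (\1_(h n @^-1` [set y]) (phi x))%:E : \bar R).
  by apply/measurable_EFinP; apply: measurableT_comp => //; exact: measurable_indic.
(* Both integrals of the simple function [h n] are expanded over its finitely many values, and [nuE]
   identifies them level set by level set. *)
transitivity (\sum_(y \in range (h n)) (y%:E * nu (h n @^-1` [set y]))).
  by rewrite integralT_nnsfun sintegralE.
transitivity (\int[m]_x (\sum_(y \in range (h n))
    (y%:E * ((w x)%:E * (\1_(h n @^-1` [set y]) (phi x))%:E)))); last first.
  apply: eq_integral => x _; rewrite [in RHS](fimfunE (h n)) -fsumEFin//.
  rewrite ge0_mule_fsumr; last by move=> y; rewrite EFinM nnfun_muleindic_ge0.
  by apply: eq_fsbigr => y _; rewrite muleCA EFinM.
rewrite ge0_integral_fsum//; last 2 first.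
- by move=> y; apply: emeasurable_funM => //; exact: emeasurable_funM.
- move=> y x _; rewrite muleCA mule_ge0 ?lee_fin//.
  by have := nnfun_muleindic_ge0 (h n) y (phi x).
apply: eq_fsbigr => y /set_mem[z _ <-].
rewrite ge0_integralZl_EFin//; first by rewrite nuE.
- by move=> x _; rewrite mule_ge0 ?lee_fin.
- exact: emeasurable_funM.
Qed.

(** The positive and negative parts are treated separately; the non-negative factor [w x] commutes
    with taking either part. *)
Lemma integral_weighted_image (f : T2 -> R) : measurable_fun setT f ->
  \int[nu]_y (f y)%:E = \int[m]_x (w x * f (phi x))%:E.
Proof.
move=> mf; rewrite [LHS]integralE [RHS]integralE.
have mfE : measurable_fun setT (EFin \o f) by exact/measurable_EFinP.
rewrite !ge0_integral_weighted_image//; last 2 first.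
- exact: measurable_funeneg.
- exact: measurable_funepos.
congr (_ - _); apply: eq_integral => x _.
- by rewrite !funeposE -!EFin_max -EFinM maxr_pMr// mulr0.
- by rewrite !funenegE -!EFinN -!EFin_max -EFinM maxr_pMr// mulr0 mulrN.
Qed.

End weighted_image_measure.

(** * Affine substitution on the real line *)

Section affine_substitution.
Local Open Scope ereal_scope.
Variable R : realType.
Notation muR := (@lebesgue_measure R).

Lemma measurable_affine (a b : R) :
  measurable_fun setT ((fun x => a * x + b)%R : measurableTypeR R -> measurableTypeR R).
Proof.
apply: measurable_funD => //; apply: measurable_funM => //.
Qed.

Lemma ge0_integral_affine (a b : R) (F : R -> \bar R) : (0 < a)%R ->
  measurable_fun [set: measurableTypeR R] F -> (forall x, 0 <= F x) ->
  \int[muR]_x F x = a%:E * \int[muR]_x F (a * x + b)%R.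
Proof.
move=> a0 mF F0; pose phi := (fun x => a * x + b)%R : measurableTypeR R -> measurableTypeR R.
have mphi : measurable_fun setT phi by exact: measurable_affine.
pose pa : {nonneg R}%R := NngNum (ltW a0).
have E A : measurable A -> muR A = mscale pa (pushforward muR phi) A.
  (* It suffices to compare the two measures on half-open intervals, where the preimage under [phi]
     is shorter by the factor [a]. *)
  apply: lebesgue_measure_unique.
  move=> _ [[x y] _ <-].
  transitivity (a%:E * muR (phi @^-1` `]x, y])); last by [].
  rewrite (_ : phi @^-1` _ = `](x - b) / a, (y - b) / a]%classic)%R; last first.
    apply/seteqP; split=> z /=; rewrite !in_itv/= /phi ltr_pdivrMr// ler_pdivlMr//.
      by rewrite ltrBlDr lerBrDr mulrC.
    by rewrite ltrBlDr lerBrDr mulrC.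
  rewrite [LHS](lebesgue_measure_itv `]x, y])
    [X in (_ * X)](lebesgue_measure_itv `](x - b) / a, (y - b) / a])%R/=.
  rewrite !lte_fin ltr_pM2r ?invr_gt0// ltrD2r; case: ifPn => _; last by rewrite mule0.
  rewrite -!EFinB -EFinM; congr EFin.
  by field; rewrite gt_eqF.
rewrite (@ge0_integral_weighted_image _ _ _ _ _ muR muR (cst a) phi)//.
- by rewrite ge0_integralZl_EFin// ?ltW//; apply: measurableT_comp.
- by move=> x; rewrite /= ltW.
move=> A mA; transitivity (a%:E * muR (phi @^-1` A)); first exact: (E mphi).
have mpA : measurable (phi @^-1` A) by rewrite -[X in measurable X]setTI; exact: mphi.
transitivity (a%:E * \int[muR]_x (\1_(phi @^-1` A) x)%:E).
  by rewrite integral_indic// setIT.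
rewrite -ge0_integralZl_EFin ?ltW//.
- by apply/measurable_EFinP; exact: measurable_indic.
Qed.

End affine_substitution.

(** * Affine substitution for Lebesgue measure on row vectors *)

Section lebesgue_rV_substitution.
Local Open Scope ereal_scope.
Variable R : realType.

Lemma continuous_measurable_mx_prod (m n p q m' n' p' q' : nat)
    (f : 'M[R]_(m, n) * 'M[R]_(p, q) -> 'M[R]_(m', n') * 'M[R]_(p', q')) :
  continuous f -> measurable_fun setT f.
Proof.
move=> cf; apply: (measurability _ (@measurable_prod_borel R m' n' p' q')).
move=> _ [U oU <-]; rewrite setTI; apply: open_measurable_prod.
by apply: open_comp => // x _; exact: cf.
Qed.

Lemma continuous_measurable_mx (m n p q : nat)
    (f : 'M[R]_(m, n) -> 'M[R]_(p, q)) :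
  continuous f -> measurable_fun setT f.
Proof.
move=> cf; apply: (measurability (@open 'M[R]_(p, q))) => // _ [U oU <-].
rewrite setTI; apply: sub_sigma_algebra.
by apply: open_comp => // x _; exact: cf.
Qed.

Lemma measurable_affine_rV n (a : R) (b : 'rV[R]_n) :
  measurable_fun setT (fun x : 'rV[R]_n => (a *: x + b)%R).
Proof.
apply: continuous_measurable_mx => x.
have FF := @nbhs_filter _ x.
by apply: cvgD; [apply: cvgZl_tmp; exact: cvg_id|exact: cvg_cst].
Qed.

(** By construction [lebesgue_rV R n.+1] is the push-forward of a product measure under [cons_rV],
    so Tonelli's theorem separates the first coordinate. *)
Lemma ge0_integral_lebesgue_rVS n (F : 'rV[R]_n.+1 -> \bar R) :
  measurable_fun setT F -> (forall x, 0 <= F x) ->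
  \int[lebesgue_rV R n.+1]_x F x =
  \int[lebesgue_measure]_t \int[lebesgue_rV R n]_y F (cons_rV (t, y)).
Proof.
move=> mF F0; have mc := @measurable_cons_rV R n.
transitivity (\int[lebesgue_measure \x lebesgue_rV R n]_p F (cons_rV p)).
  rewrite (@ge0_integral_weighted_image _ _ _ _ _ (lebesgue_rV R n.+1)
    (lebesgue_measure \x lebesgue_rV R n) (cst 1%R) (@cons_rV R n))//.
    by apply: eq_integral => p _; rewrite mul1e.
  move=> A mA; under eq_integral do rewrite mul1e.
  have mcA : measurable (@cons_rV R n @^-1` A).
    by rewrite -[X in measurable X]setTI; exact: mc.
  transitivity (\int[lebesgue_measure \x lebesgue_rV R n]_p (\1_(@cons_rV R n @^-1` A) p)%:E).
    by rewrite integral_indic// setIT.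
  by [].
rewrite fubini_tonelli1//.
exact: measurableT_comp.
Qed.

Lemma cons_rV_affine n (a : R) (b : 'rV[R]_n.+1) (p : R * 'rV[R]_n) :
  (a *: cons_rV p + b = cons_rV (a * p.1 + (uncons_rV b).1,
                                 a *: p.2 + (uncons_rV b).2))%R.
Proof.
apply/rowP => i; case: (unliftP ord0 i) => [k ->|->].
  by rewrite mxE [X in (X + _)%R]mxE !cons_rVS !mxE.
by rewrite mxE [X in (X + _)%R]mxE !cons_rV0.
Qed.

(** Induction on the dimension: the tail contributes [a ^+ n] by the induction hypothesis, and the
    first coordinate one more factor [a] by the one-dimensional substitution. *)
Lemma ge0_integral_rV_affine n (a : R) (b : 'rV[R]_n) (F : 'rV[R]_n -> \bar R) :
  (0 < a)%R -> measurable_fun setT F -> (forall x, 0 <= F x) ->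
  \int[lebesgue_rV R n]_x F x =
  (a ^+ n)%:E * \int[lebesgue_rV R n]_x F (a *: x + b)%R.
Proof.
move=> a0; elim: n b F => [|n IH] b F mF F0.
  rewrite expr0 mul1e; apply: eq_integral => x _; congr F.
  by apply/rowP => -[].
rewrite !ge0_integral_lebesgue_rVS//; last first.
  by apply: measurableT_comp => //; exact: measurable_affine_rV.
set b' := uncons_rV b.
have mFc : measurable_fun setT (fun p : measurableTypeR R * 'rV[R]_n => F (cons_rV p)).
  by apply: measurableT_comp => //; exact: measurable_cons_rV.
(* [G] is the inner integral after the tail has been substituted, with the first coordinate still
   free. *)
pose G t := \int[lebesgue_rV R n]_y F (cons_rV (t, (a *: y + b'.2)%R)).
have mG : measurable_fun [set: measurableTypeR R] G.
  apply: (measurable_fun_fubini_tonelli_F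
    (fun p : measurableTypeR R * 'rV[R]_n => F (cons_rV (p.1, (a *: p.2 + b'.2)%R)))) => //.
  apply: (@measurableT_comp _ _ _ _ _ _ (fun p : measurableTypeR R * 'rV[R]_n => F (cons_rV p)) _
   (fun p : measurableTypeR R * 'rV[R]_n => (p.1, (a *: p.2 + b'.2)%R))) => //.
  apply: measurable_fun_pair => //.
  apply: (measurableT_comp (measurable_affine_rV a b'.2)); exact: measurable_snd.
have G0 t : 0 <= G t by exact: integral_ge0.
transitivity (\int[lebesgue_measure]_t ((a ^+ n)%:E * G t)).
  apply: eq_integral => t _; apply: IH => //.
  exact: (measurableT_comp mFc (measurable_pair1 _)).
transitivity ((a ^+ n)%:E * \int[lebesgue_measure]_t G t).
  by apply: ge0_integralZl_EFin; rewrite ?exprn_ge0 ?ltW.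
transitivity ((a ^+ n)%:E * (a%:E * \int[lebesgue_measure]_t G (a * t + b'.1)%R)).
  by congr (_ * _); exact: ge0_integral_affine.
rewrite muleA -EFinM -exprSr; congr (_ * _).
apply: eq_integral => t _; apply: eq_integral => y _.
by rewrite cons_rV_affine.
Qed.

End lebesgue_rV_substitution.

(** * Change of variables by [S_] and scaling of the Gaussian mass *)

Section rescaling_substitution.
Local Open Scope ereal_scope.
Variables (R : realType) (n : nat).
Local Notation Z := 'rV[R]_n.
Local Notation leb := (lebesgue_rV R n).

Lemma continuous_affine_pair (a b c d : R) :
  continuous (fun p : Z * Z => (a *: p.1 + b *: p.2, c *: p.1 + d *: p.2)%R).
Proof.
have lin u v : continuous (fun p : Z * Z => u *: p.1 + v *: p.2)%R.
  move=> p; apply: cvgD; apply: cvgZl_tmp; [exact: cvg_fst|exact: cvg_snd].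
by move=> p; exact: (cvg_pair (lin a b p) (lin c d p)).
Qed.

Lemma continuous_S (lambda : R) : continuous (@S_ R n lambda).
Proof.
have -> : @S_ R n lambda = fun p => ((Num.sqrt 2)^-1 *: p.1 +
    ((Num.sqrt 2)^-1 * lambda^-1) *: p.2, (Num.sqrt 2)^-1 *: p.1 +
    (- ((Num.sqrt 2)^-1 * lambda^-1)) *: p.2)%R.
  by apply/funext => p; rewrite /S_ scalerDr scalerBr scaleNr !scalerA.
exact: continuous_affine_pair.
Qed.

Lemma continuous_S_inv (lambda : R) : continuous (@S_inv R n lambda).
Proof.
have -> : @S_inv R n lambda = fun p => ((Num.sqrt 2)^-1 *: p.1 +
    (Num.sqrt 2)^-1 *: p.2, (lambda * (Num.sqrt 2)^-1) *: p.1 +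
    (- (lambda * (Num.sqrt 2)^-1)) *: p.2)%R.
  by apply/funext => p; rewrite /S_inv scalerDr scalerBr scaleNr scalerBr !scalerA.
exact: continuous_affine_pair.
Qed.

Lemma measurable_S (lambda : R) : measurable_fun setT (@S_ R n lambda).
Proof. by apply: continuous_measurable_mx_prod; exact: continuous_S. Qed.

Lemma measurable_S_inv (lambda : R) : measurable_fun setT (@S_inv R n lambda).
Proof. by apply: continuous_measurable_mx_prod; exact: continuous_S_inv. Qed.

(* S_ lambda is the shear p |-> (p.1, y), with y the first component of
   S_ lambda p, followed by p |-> (p.2, sqrt 2 p.1 - p.2); each of the two acts
   affinely on a single variable. *)
Lemma ge0_integral_S (lambda : R) (F : Z * Z -> \bar R) : (0 < lambda)%R ->
  measurable_fun setT F -> (forall p, 0 <= F p) ->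
  \int[leb \x leb]_p F p =
  (lambda^-1 ^+ n)%:E * \int[leb \x leb]_p F (S_ lambda p).
Proof.
move=> l0 mF F0; pose s : R := Num.sqrt 2.
have s0 : (0 < s)%R by rewrite sqrtr_gt0.
have ss : (s - s^-1 = s^-1)%R.
  apply: (mulIf (lt0r_neq0 s0)); rewrite mulrBl mulVf ?lt0r_neq0// -expr2.
  by rewrite sqr_sqrtr//; ring.
(* This is the coefficient of the second variable in [(S_ lambda p).1]. Since [s * a] equals
   [lambda^-1], the factors [s ^+ n] and [a ^+ n] of the two steps multiply to the stated
   Jacobian. *)
pose a := (lambda^-1 * s^-1)%R.
have a0 : (0 < a)%R by rewrite mulr_gt0 ?invr_gt0.
pose H (p : Z * Z) := F (p.2, (s *: p.1 - p.2)%R).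
have mH : measurable_fun setT H.
  apply: measurableT_comp => //; apply: continuous_measurable_mx_prod.
  rewrite [X in continuous X](_ : _ =
      fun p : Z * Z => (0 *: p.1 + 1 *: p.2, s *: p.1 + (- 1) *: p.2)%R).
    exact: continuous_affine_pair.
  by apply/funext => p; rewrite scale0r add0r scale1r scaleN1r.
have H0 p : 0 <= H p by exact: F0.
transitivity (\int[leb]_y ((s ^+ n)%:E * \int[leb]_x H (x, y))).
  rewrite fubini_tonelli1//; apply: eq_integral => y _.
  apply: (@ge0_integral_rV_affine _ _ s (- y)%R (fun z => F (y, z))) => //.
  exact: (measurableT_comp mF (measurable_pair1 y)).
transitivity ((s ^+ n)%:E * \int[leb]_y \int[leb]_x H (x, y)).
  apply: ge0_integralZl_EFin => //; rewrite ?exprn_ge0 ?ltW//.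
    by move=> y _; exact: integral_ge0.
  exact: (measurable_fun_fubini_tonelli_G H).
pose K (p : Z * Z) := F (S_ lambda p).
have mK : measurable_fun setT K.
  by apply: measurableT_comp => //; exact: measurable_S.
have K0 p : 0 <= K p by exact: F0.
have HK x y : H (x, (a *: y + s^-1 *: x)%R) = K (x, y).
  rewrite /K /H /S_ /= -/s; congr (F (_, _)); apply/rowP => i; rewrite !mxE/= /a.
    by ring.
  have -> : (s * x 0 i = (s^-1 + s^-1) * x 0 i)%R by congr (_ * _)%R; lra.
  by ring.
transitivity ((s ^+ n)%:E * \int[leb]_x ((a ^+ n)%:E * \int[leb]_y K (x, y))).
  rewrite -fubini_tonelli//; congr (_ * _); apply: eq_integral => x _.
  rewrite (@ge0_integral_rV_affine _ _ a (s^-1 *: x)%R (fun y => H (x, y)))//.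
    by congr (_ * _); apply: eq_integral => y _; exact: HK.
  exact: (measurableT_comp mH (measurable_pair1 x)).
transitivity ((s ^+ n)%:E * ((a ^+ n)%:E * \int[leb]_x \int[leb]_y K (x, y))).
  congr (_ * _); apply: ge0_integralZl_EFin => //; rewrite ?exprn_ge0 ?ltW//.
    by move=> y _; exact: integral_ge0.
  exact: (measurable_fun_fubini_tonelli_F K).
rewrite muleA -EFinM -exprMn fubini_tonelli1//.
by congr ((_ ^+ _)%:E * _); rewrite /a; field; rewrite !gt_eqF.
Qed.

(** The exceptional set [N] has measure [lambda^-1 ^+ n] times that of its preimage under
    [S_ lambda]. This factor is nonzero, so the preimage is null as well. *)
Lemma ae_S (lambda : R) (P : set (Z * Z)) : (0 < lambda)%R ->
  {ae leb \x leb, forall p, P p} -> {ae leb \x leb, forall p, P (S_ lambda p)}.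
Proof.
move=> l0 [N [mN N0 PN]]; have mS := @measurable_S lambda.
have mSN : measurable (@S_ R n lambda @^-1` N).
  by rewrite -[X in measurable X]setTI; exact: mS.
exists (@S_ R n lambda @^-1` N); split => //; last by move=> p; exact: PN.
have : (leb \x leb) N = (lambda^-1 ^+ n)%:E * (leb \x leb) (@S_ R n lambda @^-1` N).
  transitivity (\int[leb \x leb]_p (\1_N p)%:E).
    by rewrite integral_indic// setIT.
  rewrite (@ge0_integral_S lambda)//; last first.
    by apply/measurable_EFinP; exact: measurable_indic.
  congr (_ * _); transitivity (\int[leb \x leb]_p (\1_(@S_ R n lambda @^-1` N) p)%:E).
    by [].
  by rewrite integral_indic// setIT.
rewrite [LHS]N0 => /esym/eqP; rewrite mule_eq0 => /orP[|/eqP//].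
by rewrite eqe expf_eq0 invr_eq0 gt_eqF ?andbF.
Qed.

Variable dot : {dot 'rV[R]_n for idfun}.

Lemma norm_of_sqr (x : Z) : (norm_of dot x ^+ 2 = dot x x)%R.
Proof. by rewrite sqr_sqrtr// dot_ge0. Qed.

Lemma norm_of_sqrZ (a : R) (x : Z) :
  (norm_of dot (a *: x) ^+ 2 = a ^+ 2 * norm_of dot x ^+ 2)%R.
Proof. by rewrite !norm_of_sqr linearZl_LR linearZr_LR /= mulrA. Qed.

Lemma gauss_mass_scale (lambda beta0 : R) : (0 < lambda)%R ->
  gauss_mass dot (lambda ^+ 2 * beta0) =
  (lambda^-1 ^+ n * gauss_mass dot beta0)%R.
Proof.
move=> l0; rewrite /gauss_mass /Rintegral.
have mE (b : R) : measurable_fun setT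
    (fun x : Z => (expR (b * norm_of dot x ^+ 2))%:E).
  apply/measurable_EFinP; apply: measurableT_comp => //.
  apply: measurable_funM => //; apply: measurable_funX.
  apply: (measurability _ (RGenOpens.measurableE R)).
  move=> _ [_ [a [b' ->] <-]]; rewrite setTI; apply: sub_sigma_algebra.
  apply: open_comp; last exact: interval_open.
  by move=> x _; exact: continuous_norm_of.
rewrite (@ge0_integral_rV_affine _ _ lambda 0%R _ l0 (mE (- beta0)%R)); last first.
  by move=> x; rewrite lee_fin expR_ge0.
under [in RHS]eq_integral do rewrite addr0 norm_of_sqrZ mulrA mulNr [(beta0 * _)%R]mulrC.
(* No finiteness of the Gaussian integral is established here: for an infinite [I], [fine] returns 0
   on both sides. *)
set I := (X in fine X = _); rewrite -[in RHS]/I.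
case: I => [r| |] /=.
- by rewrite mulrA -exprMn mulVf ?gt_eqF// expr1n mul1r.
- by rewrite mulr_infty gtr0_sg ?exprn_gt0// mul1e/= mulr0.
- by rewrite mulr_infty gtr0_sg ?exprn_gt0// mul1e/= mulr0.
Qed.

End rescaling_substitution.

(** * Radon property of thermalized measures *)

Section radon_thermalized.
Variables (R : realType) (n : nat).
Local Notation Z := 'rV[R]_n.
Variable dot : {dot 'rV[R]_n for idfun}.

Lemma compact_measurable_prod (K : set (Z * Z)) : compact K -> measurable K.
Proof.
move=> cK; rewrite -[K]setCK; apply: measurableC; apply: open_measurable_prod.
by apply: closed_openC; apply: compact_closed.
Qed.

Lemma thermal_weight_le beta (p : Z * Z) : 0 <= beta ->
  thermal_weight dot beta p <= (gauss_mass dot beta)^-1.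
Proof.
move=> b0; rewrite /thermal_weight ler_piMr ?invr_ge0 ?gauss_mass_ge0//.
by rewrite -expR0 ler_expR mulNr oppr_le0 mulr_ge0// sqr_ge0.
Qed.

Local Open Scope ereal_scope.

(** Inner regularity of [nu] leaves a small remainder only on sets of finite [nu]-measure, so [A] is
    first cut by compact boxes. On each piece the bound on the weight turns a small [nu]-remainder
    into a small thermalized one. *)
Lemma bounded_radon_thermalized beta (nu : {measure set (Z * Z) -> \bar R}) :
  (0 <= beta)%R -> radon nu -> thermalized dot beta nu setT < +oo ->
  bounded_radon (thermalized dot beta nu).
Proof.
move=> b0 [nuK nuE] tauT.
pose tau : {measure set (Z * Z) -> \bar R} := thermalized dot beta nu.
have {}tauT : tau setT < +oo by exact: tauT.
rewrite -/tau.
have tau_lt A : measurable A -> tau A < +oo.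
  by move=> mA; apply: le_lt_trans tauT; apply: le_measure; rewrite ?inE.
split => //; split => [K cK|A mA].
  by apply: tau_lt; exact: (compact_measurable_prod cK).
set s := ereal_sup _.
apply/eqP; rewrite eq_le; apply/andP; split; last first.
  apply: ge_ereal_sup => _ [K /= [cK KA] <-].
  by apply: le_measure => //; rewrite inE//; exact: (compact_measurable_prod cK).
pose D k : set Z := [set x : 'rV[R]_n | forall i, `[(- k%:R)%R, (k%:R : R)%R]%classic (x ord0 i)].
have cD k : compact (D k `*` D k).
  have cDk : compact (D k).
    apply: (@rV_compact _ n (fun=> `[(- k%:R)%R, (k%:R : R)%R]%classic)) => _.
    exact: segment_compact.
  exact: (compact_setX cDk cDk).
have mD k := compact_measurable_prod (cD k).
have DT : \bigcup_k (A `&` (D k `*` D k)) = A.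
  apply/seteqP; split => [p [k _ []]//|p Ap].
  (* The sum dominates every coordinate of both components, so the box of any integer size above it
     contains [p]. *)
  pose M := (\sum_j (`|p.1 0%R j| + `|p.2 0%R j|))%R.
  exists (Num.truncn M).+1 => //.
  have leM i : ((`|p.1 0%R i| + `|p.2 0%R i|) <= (Num.truncn M).+1%:R)%R.
    apply: le_trans (ltW (truncnS_gt M)); rewrite /M (bigD1 i)//= lerDl.
    by apply: sumr_ge0 => j _; rewrite addr_ge0.
  split => //; split => i; rewrite /= in_itv/= -ler_norml.
    by apply: le_trans (leM i); rewrite lerDl.
  by apply: le_trans (leM i); rewrite lerDr.
have DS k l : (k <= l)%N -> D k `<=` D l.
  move=> kl x Dx i; have := Dx i; rewrite /= !in_itv/= -!ler_norml => /le_trans.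
  by apply; rewrite ler_nat.
have ndD : {homo (fun k => A `&` (D k `*` D k)) : k l / (k <= l)%N >-> (k <= l)%O}.
  move=> k l kl; apply/subsetPset => p [Ap [D1 D2]].
  by split => //; split; exact: DS kl _ _.
have mAD k : measurable (A `&` (D k `*` D k)) by exact: measurableI.
(* Continuity from below reduces the bound for [A] to its intersections with the boxes. *)
have := nondecreasing_cvg_mu (mu := tau) mAD.
rewrite DT => /(_ mA ndD) /cvg_lim <-//.
apply: lime_le; first by apply: ereal_nondecreasing_is_cvgn => k l kl;
  apply: le_measure; rewrite ?inE//; apply/subsetPset; exact: ndD.
apply: nearW => k; rewrite /comp; set E := A `&` _.
have mE : measurable E by exact: mAD.
have nuEoo : nu E < +oo.
  by apply: le_lt_trans (nuK _ (cD k)); apply: le_measure; rewrite ?inE//; exact: subIsetr.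
apply/lee_addgt0Pr => e e0.
pose C : R := ((gauss_mass dot beta)^-1)%R.
have C0 : (0 <= C)%R by rewrite invr_ge0 gauss_mass_ge0.
(* Dividing by [C + 1] keeps the tolerance meaningful when [C] is 0, and [C * (e / (C + 1))] is
   still at most [e]. *)
have d0 : (0 < e / (C + 1))%R by rewrite divr_gt0// ltr_wpDl.
have [_ [K [cK KE] <-] EK] : exists2 x,
    [set nu K | K in [set K | compact K /\ K `<=` E]] x & nu E - (e / (C + 1))%:E < x.
  rewrite [in nu E](nuE _ mE); apply: ub_ereal_sup_adherent => //.
  by rewrite -nuE// ge0_fin_numE.
have mK := compact_measurable_prod cK.
have mEK : measurable (E `\` K) by exact: measurableD.
have nuEK : nu (E `\` K) <= (e / (C + 1))%:E.
  rewrite measureD// setIidr//; have nuKoo := le_lt_trans (le_measure nu _ _ KE) nuEoo.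
  rewrite leeBlDr ?ge0_fin_numE ?nuKoo ?inE//.
  by rewrite addeC -leeBlDr// ltW.
rewrite (measureDI tau mE mK) setIidr// addeC; apply: leeD.
  apply: ereal_sup_ubound; exists K => //; split => //.
  by apply: subset_trans KE _; exact: subIsetl.
rewrite /tau/= /thermalized.
have : \int[nu]_(p in E `\` K) (thermal_weight dot beta p)%:E <= C%:E * nu (E `\` K).
  rewrite -integral_cst//; apply: ge0_le_integral => //.
  - by move=> p _; rewrite lee_fin thermal_weight_ge0.
  - apply/measurable_EFinP; apply: measurable_funS (measurable_thermal_weight _ _) => //.
  - by move=> p _; rewrite lee_fin thermal_weight_le.
move=> /le_trans; apply; apply: (@le_trans _ _ (C%:E * (e / (C + 1))%:E)).
  by rewrite lee_wpmul2l.
by rewrite -EFinM lee_fin mulrA ler_pdivrMr ?ltr_wpDl// [leRHS]mulrC ler_pM2r// lerDl.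
Qed.

End radon_thermalized.

(** * Thermalized measures in rescaled coordinates *)

Section rescaled_thermalization.
Variables (R : realType) (n : nat) (dot : {dot 'rV[R]_n for idfun}).
Local Notation Z := 'rV[R]_n.
Local Notation leb := (lebesgue_rV R n).

(** The two components of [S_ lambda q] differ by [sqrt 2 / lambda] times [q.2], so [lambda] drops
    out of the exponent; the prefactor cancels by [gauss_mass_scale]. *)
Lemma thermal_weight_S (lambda beta0 : R) (q : Z * Z) : 0 < lambda ->
  lambda^-1 ^+ n * thermal_weight dot (lambda ^+ 2 * beta0) (S_ lambda q) =
  thermal_weight_bar dot beta0 q.2.
Proof.
move=> l0; have ln0 : lambda != 0 by rewrite gt_eqF.
rewrite /thermal_weight gauss_mass_scale// invfM mulrA mulrA divff ?mul1r; last first.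
  by rewrite expf_neq0// invr_neq0.
congr (_ * expR _); rewrite /S_ /=.
have -> : (Num.sqrt 2)^-1 *: (q.1 + lambda^-1 *: q.2) -
    (Num.sqrt 2)^-1 *: (q.1 - lambda^-1 *: q.2) =
    (2 * lambda^-1 * (Num.sqrt 2)^-1) *: q.2 :> Z.
  by apply/rowP => i; rewrite !mxE; ring.
rewrite norm_of_sqrZ !exprMn !exprVn sqr_sqrtr//.
by field.
Qed.

Local Open Scope ereal_scope.

Lemma integral_indic_mule d (X : measurableType d) (m : {measure set X -> \bar R})
    (A : set X) (F : X -> \bar R) :
  \int[m]_(x in A) F x = \int[m]_x (F x * (\1_A x)%:E).
Proof. by rewrite integral_mkcond epatch_indic. Qed.

Section density.
Variables (mu nu : {measure set (Z * Z) -> \bar R}) (L : Z * Z -> R).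
Hypotheses (mL : measurable_fun setT L) (L0 : forall p, (0 <= L p)%R).
Hypothesis muE : forall A, measurable A ->
  mu A = \int[leb \x leb]_(p in A) (L p)%:E.
Variable T : Z * Z -> Z * Z.
Hypothesis mT : measurable_fun setT T.
Hypothesis nuE : forall A, measurable A -> nu A = mu (T @^-1` A).

(** Three substitutions in turn: [T] carries the integral from [nu] to [mu], the density [L] carries
    it to Lebesgue measure, and [S_ lambda] rescales the variables. *)
Lemma thermalized_rescaled (lambda beta0 : R) A : (0 < lambda)%R ->
  measurable A -> thermalized dot (lambda ^+ 2 * beta0) nu A =
  \int[leb \x leb]_p
    ((thermal_weight_bar dot beta0 (S_inv lambda (T (S_ lambda p))).2 *
      L (S_ lambda p))%:E * (\1_A (T (S_ lambda p)))%:E).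
Proof.
move=> l0 mA; rewrite /thermalized integral_indic_mule.
set w := thermal_weight dot _.
have w0 p : (0 <= w p)%R by exact: thermal_weight_ge0.
have m1 : measurable_fun setT (fun p : Z * Z => (\1_A p : R)%:E).
  by apply/measurable_EFinP; exact: measurable_indic.
have mw : measurable_fun setT (EFin \o w).
  by apply/measurable_EFinP; exact: measurable_thermal_weight.
pose F p := (w p)%:E * (\1_A p)%:E.
have mF : measurable_fun setT F by exact: emeasurable_funM.
have F0 p : 0 <= F p by rewrite mule_ge0 ?lee_fin.
have mFT : measurable_fun setT (F \o T) by exact: measurableT_comp.
have mLE : measurable_fun setT (EFin \o L) by exact/measurable_EFinP.
transitivity (\int[mu]_p F (T p)).
  rewrite (@ge0_integral_weighted_image _ _ _ _ _ nu mu (cst 1%R) T)//.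
    by apply: eq_integral => p _; rewrite mul1e.
  move=> B mB; under eq_integral do rewrite mul1e.
  have mTB : measurable (T @^-1` B) by rewrite -[X in measurable X]setTI; exact: mT.
  transitivity (\int[mu]_p (\1_(T @^-1` B) p)%:E); last by [].
  by rewrite integral_indic// setIT nuE.
transitivity (\int[leb \x leb]_p ((L p)%:E * F (T p))).
  rewrite (@ge0_integral_weighted_image _ _ _ _ _ mu (leb \x leb) L idfun)//.
    exact: measurable_id.
  move=> B mB; transitivity (\int[leb \x leb]_(p in B) (L p)%:E); first exact: muE.
  exact: integral_indic_mule.
have mLF : measurable_fun setT (fun p => (L p)%:E * F (T p)) by exact: emeasurable_funM.
have LF0 p : 0 <= (L p)%:E * F (T p).
  by apply: mule_ge0; [rewrite lee_fin|exact: F0].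
rewrite (@ge0_integral_S _ _ lambda)// -ge0_integralZl_EFin//; last 2 first.
- by apply: measurableT_comp mLF _; exact: measurable_S.
- by rewrite exprn_ge0// invr_ge0 ltW.
apply: eq_integral => p _.
(* The weight identity is applied at the rescaled coordinates of [T (S_ lambda p)], which [S_invK]
   maps back to that point. *)
rewrite -(@thermal_weight_S lambda)// S_invK// -/w.
rewrite /F muleA -!EFinM; congr EFin; ring.
Qed.

End density.

End rescaled_thermalization.

(** For Borel representatives of [L] and [g], the bound in (vi) survives only almost everywhere,
    hence this form of domination. *)
Lemma ae_le_integrable d (X : measurableType d) (R : realType)
    (m : {measure set X -> \bar R}) (f g : X -> \bar R) :
  measurable_fun setT f -> m.-integrable setT g ->
  {ae m, forall x, (`|f x| <= `|g x|)%E} -> m.-integrable setT f.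
Proof.
move=> mf ig fg; have mg := measurable_int _ ig.
apply/integrableP; split => //; case/integrableP: ig => _; apply: le_lt_trans.
apply: ae_ge0_le_integral => //.
- exact: measurableT_comp.
- exact: measurableT_comp.
- by apply: filterS fg.
Qed.

(** * Limits of the weights and of the rescaling *)

Section asymptotics.
Variables (R : realType) (n : nat) (dot : {dot 'rV[R]_n for idfun}).
Local Notation Z := 'rV[R]_n.

Lemma continuous_thermal_weight_bar beta :
  continuous (thermal_weight_bar dot beta).
Proof.
move=> x; have FF := @nbhs_filter _ x.
apply: (@cvgMl_tmp _ _ _ FF).
apply: (@continuous_comp Z R R (fun y => - (2 * beta) * norm_of dot y ^+ 2) expR x);
  last exact: continuous_expR.
apply: (@cvgMl_tmp _ _ _ FF).
apply: (@continuous_comp Z R R (norm_of dot) (fun x => x ^+ 2) x);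
  [exact: continuous_norm_of|exact: exprn_continuous].
Qed.

Lemma measurable_thermal_weight_bar beta :
  measurable_fun setT (fun p : Z * Z => thermal_weight_bar dot beta p.2).
Proof.
apply: continuous_measurable_prod => p.
apply: (@continuous_comp (Z * Z)%type Z R snd _ p); first exact: cvg_snd.
exact: continuous_thermal_weight_bar.
Qed.

(** Supplies for [mu] itself, where the map is the identity, the limit that (v) provides for
    [T h]. *)
Lemma cvg_S (lambda_ : nat -> R) (p : Z * Z) :
  lambda_ h @[h --> \oo] --> +oo ->
  S_ (lambda_ h) p @[h --> \oo] -->
  ((Num.sqrt 2)^-1 *: p.1, (Num.sqrt 2)^-1 *: p.1).
Proof.
move=> loo.
have l0 : (lambda_ h)^-1 *: p.2 @[h --> \oo] --> (0 : Z).
  rewrite -[X in _ --> X](scale0r p.2); apply: cvgZr_tmp.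
  apply/gtr0_cvgV0 => //.
  by apply: (cvgryPgt lambda_).1 loo 0.
have cst1 : p.1 @[_ --> \oo] --> p.1 by exact: cvg_cst.
have c1 : (Num.sqrt 2)^-1 *: (p.1 + (lambda_ h)^-1 *: p.2) @[h --> \oo] -->
    (Num.sqrt 2)^-1 *: p.1.
  have := cvgD cst1 l0; rewrite addr0 => c; apply: cvgZl_tmp. exact: c.
have c2 : (Num.sqrt 2)^-1 *: (p.1 - (lambda_ h)^-1 *: p.2) @[h --> \oo] -->
    (Num.sqrt 2)^-1 *: p.1.
  have := cvgB cst1 l0; rewrite subr0 => c; apply: cvgZl_tmp. exact: c.
have FF := @eventually_filter.
exact: (cvg_pair c1 c2).
Qed.

Lemma sqrt_cvg_pinfty (beta : nat -> R) (beta0 : R) : 0 < beta0 ->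
  beta h @[h --> \oo] --> +oo ->
  Num.sqrt (beta h / beta0) @[h --> \oo] --> +oo.
Proof.
move=> b0 boo; apply/cvgryPge => A.
(* Beyond this threshold the square root is at least the absolute value of [A]. *)
move/cvgryPge : boo => /(_ (A ^+ 2 * beta0)); apply: filterS => h.
rewrite -ler_pdivlMr// => /ler_wsqrtr; rewrite sqrtr_sqr.
by apply: le_trans; exact: ler_norm.
Qed.

End asymptotics.

(** * Weak convergence of the difference of the thermalized measures *)

Theorem theorem5p1 (R : realType) (N : nat) (hN : (1 <= N)%N)
  (dot : {dot 'rV[R]_(2 * N) for idfun})
  (mu : {measure set ('rV[R]_(2 * N) * 'rV[R]_(2 * N)) -> \bar R})
  (hmu : radon mu)
  (* (i) *)
  (L : 'rV[R]_(2 * N) * 'rV[R]_(2 * N) -> R)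
  (hLloc : in_L1loc L)
  (hL0 : forall p, 0 <= L p)
  (hmuL : forall A, measurable A ->
    mu A = (\int[lebesgue_rV R (2 * N) \x lebesgue_rV R (2 * N)]_(p in A)
              (L p)%:E)%E)
  (* (ii) *)
  (Lhat : 'rV[R]_(2 * N) -> R)
  (hLhat : {ae (lebesgue_rV R (2 * N) \x lebesgue_rV R (2 * N))%E, forall p,
     L (S_ lambda p) @[lambda --> +oo] --> Lhat ((Num.sqrt 2)^-1 *: p.1)})
  (* (iii) *)
  (g0 : 'rV[R]_(2 * N) * 'rV[R]_(2 * N) -> R) (lambda0 beta0 : R)
  (hg0 : in_L1 g0) (hlambda0 : 0 < lambda0) (hbeta0 : 0 < beta0)
  (hLg0 : {ae (lebesgue_rV R (2 * N) \x lebesgue_rV R (2 * N))%E, forall p,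
     forall lambda, lambda0 <= lambda ->
       thermal_weight_bar dot beta0 p.2 * L (S_ lambda p) <= g0 p})
  (mu_ : nat -> {measure set ('rV[R]_(2 * N) * 'rV[R]_(2 * N)) -> \bar R})
  (hmu_ : forall h, radon (mu_ h))
  (* (iv) *)
  (T : nat -> 'rV[R]_(2 * N) * 'rV[R]_(2 * N) ->
       'rV[R]_(2 * N) * 'rV[R]_(2 * N))
  (hT : forall h, measurable_fun setT (T h))
  (hmuT : forall h A, measurable A -> mu_ h A = pushforward mu (T h) A)
  (* (v) *)
  (beta lambda_ : nat -> R)
  (hbeta : forall h, 0 < beta h)
  (hbetaoo : beta h @[h --> \oo] --> +oo)
  (hlambda : forall h, lambda_ h = Num.sqrt (beta h / beta0))
  (hTlim : forall p, T h (S_ (lambda_ h) p) @[h --> \oo] -->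
     ((Num.sqrt 2)^-1 *: p.1, (Num.sqrt 2)^-1 *: p.1))
  (hetalim : forall p,
     (S_inv (lambda_ h) (T h (S_ (lambda_ h) p))).2 @[h --> \oo] --> p.2)
  (* (vi) *)
  (g : 'rV[R]_(2 * N) * 'rV[R]_(2 * N) -> R) (h0 : nat)
  (hg : in_L1 g)
  (hLg : forall h, (h0 <= h)%N -> forall p,
     (thermal_weight_bar dot beta0 p.2 +
      thermal_weight_bar dot beta0
        (S_inv (lambda_ h) (T h (S_ (lambda_ h) p))).2) *
     L (S_ (lambda_ h) p) <= g p) :
  (\forall h \near \oo,
     bounded_radon (thermalized dot (beta h) (mu_ h)) /\
     bounded_radon (thermalized dot (beta h) mu)) /\
  forall f : 'rV[R]_(2 * N) * 'rV[R]_(2 * N) -> R,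
    continuous f -> bounded_fun f ->
    (\int[thermalized dot (beta h) (mu_ h)]_p f p -
     \int[thermalized dot (beta h) mu]_p f p) @[h --> \oo] --> 0.
Proof.
pose Z := 'rV[R]_(2 * N); pose leb := lebesgue_rV R (2 * N).
pose wb := thermal_weight_bar dot beta0.
have l0 h : 0 < lambda_ h by rewrite hlambda sqrtr_gt0 divr_gt0.
have lb h : lambda_ h ^+ 2 * beta0 = beta h.
  by rewrite hlambda sqr_sqrtr ?divr_ge0 ?ltW// divfK// gt_eqF.
have loo : lambda_ h @[h --> \oo] --> +oo.
  by rewrite (_ : lambda_ = fun h => Num.sqrt (beta h / beta0));
    [exact: sqrt_cvg_pinfty|apply/funext].
case: hLloc => L0 [mL0 _ LL0].
(* L is only Lebesgue measurable: L' is a non-negative Borel representative. *)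
pose L' p := Num.max (L0 p) 0.
have mL' : measurable_fun setT L' by exact: measurable_maxr.
have L'0 p : 0 <= L' p by rewrite le_max lexx orbT.
have LL' : {ae (leb \x leb)%E, forall p, L p = L' p}.
  by apply: filterS LL0 => p Lp; rewrite /L' -Lp max_l.
have muE A : measurable A -> mu A = (\int[leb \x leb]_(p in A) (L' p)%:E)%E.
  move=> mA; rewrite hmuL//; apply: ge0_ae_eq_integral_sup.
  - by move=> p _; rewrite lee_fin.
  - by move=> p _; rewrite lee_fin.
  - by apply: filterS LL' => p -> _.
case: hg => g' ig' gg'.
pose S h := @S_ R (2 * N) (lambda_ h).
have mS h : measurable_fun setT (S h) by exact: measurable_S.
have mTS h : measurable_fun setT (T h \o S h) by exact: measurableT_comp.
pose eta h p := (S_inv (lambda_ h) (T h (S h p))).2.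
(* A countable union of null sets is null, so one exceptional set serves all [h]. *)
have LS : {ae (leb \x leb)%E, forall p, forall h, L (S h p) = L' (S h p)}.
  by apply: ae_foralln => h; exact: (ae_S (l0 h) LL').
(* [W h] and [V h] are the densities, in the coordinates of [S h], whose images under [T h \o S h]
   and [S h] are the two thermalized measures. *)
pose W h p := wb (eta h p) * L' (S h p).
pose V h p := wb p.2 * L' (S h p).
have wb0 x : 0 <= wb x.
  by rewrite mulr_ge0 ?invr_ge0 ?gauss_mass_ge0 ?expR_ge0.
have W0 h p : 0 <= W h p by rewrite mulr_ge0.
have V0 h p : 0 <= V h p by rewrite mulr_ge0.
have mwb := @measurable_thermal_weight_bar R (2 * N) dot beta0.
have mW h : measurable_fun setT (W h).
  apply: measurable_funM; last exact: measurableT_comp.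
  exact: (measurableT_comp mwb (measurableT_comp (measurable_S_inv _) (mTS h))).
have mV h : measurable_fun setT (V h).
  by apply: measurable_funM => //; exact: measurableT_comp.
have WVg : {ae (leb \x leb)%E, forall p, forall h, (h0 <= h)%N ->
    W h p + V h p <= g' p}.
  apply: filterS2 LS gg' => p LSp gp h h0h.
  by rewrite /W /V -mulrDl -LSp -gp addrC; exact: hLg.
have tauW h A : measurable A -> thermalized dot (beta h) (mu_ h) A =
    (\int[leb \x leb]_p ((W h p)%:E * (\1_A (T h (S h p)))%:E))%E.
  move=> mA; rewrite -lb.
  exact: (thermalized_rescaled dot mL' L'0 muE (hT h) (hmuT h) beta0 (l0 h) mA).
have tauV h A : measurable A -> thermalized dot (beta h) mu A =
    (\int[leb \x leb]_p ((V h p)%:E * (\1_A (S h p))%:E))%E.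
  move=> mA; rewrite -lb.
  (* The measure [mu] is its own push-forward by the identity; [S_K] then recovers [p.2] as the
     argument of the weight. *)
  rewrite (thermalized_rescaled dot mL' L'0 muE (@measurable_id _ _ _)
    (fun A _ => erefl (mu A)) beta0 (l0 h) mA).
  by apply: eq_integral => p _; rewrite S_K.
(* Used with [U] equal to [W h] or [V h]: for [f = 1] it gives finite total mass, and for a test
   function it allows the two integrals to be subtracted. *)
have intU (U f : Z * Z -> R) (phi : Z * Z -> Z * Z) M :
    measurable_fun setT U -> (forall p, 0 <= U p) ->
    {ae (leb \x leb)%E, forall p, U p <= g' p} ->
    measurable_fun setT phi -> measurable_fun setT f ->
    (forall p, `|f p| <= M) ->
    (leb \x leb)%E.-integrable setT (fun p => (U p * f (phi p))%:E).
  move=> mU U0 Ug mphi mf fM.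
  apply: (@ae_le_integrable _ _ _ _ _ (fun p => M%:E * (g' p)%:E)%E).
  - by apply/measurable_EFinP; apply: measurable_funM => //; exact: measurableT_comp.
  - exact: integrableZl.
  - apply: filterS Ug => p Up; rewrite -EFinM !abse_EFin lee_fin.
    apply: le_trans (ler_norm _); rewrite normrM ger0_norm// mulrC.
    exact: ler_pM.
have Wg h : (h0 <= h)%N -> {ae (leb \x leb)%E, forall p, W h p <= g' p}.
  by move=> h0h; apply: filterS WVg => p /(_ _ h0h); apply: le_trans; rewrite lerDl.
have Vg h : (h0 <= h)%N -> {ae (leb \x leb)%E, forall p, V h p <= g' p}.
  by move=> h0h; apply: filterS WVg => p /(_ _ h0h); apply: le_trans; rewrite lerDr.
have cst1 (p : Z * Z) : `|cst 1 p| <= 1 :> R by rewrite normr1.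
split.
  exists h0 => // h /= h0h; split; apply: bounded_radon_thermalized => //.
  - exact/ltW.
  - rewrite tauW//.
    apply: le_lt_trans (integrable_lty measurableT
      (intU _ _ _ _ (mW h) (W0 h) (Wg _ h0h) (mTS h) (measurable_cst _) cst1)).
    by rewrite le_eqVlt; apply/orP; left; apply/eqP/eq_integral => p _; rewrite indicT.
  - exact/ltW.
  - rewrite tauV//.
    apply: le_lt_trans (integrable_lty measurableT
      (intU _ _ _ _ (mV h) (V0 h) (Vg _ h0h) (mS h) (measurable_cst _) cst1)).
    by rewrite le_eqVlt; apply/orP; left; apply/eqP/eq_integral => p _; rewrite indicT.
move=> f cf [M0 [_ fM0]].
(* [bounded_fun] yields a bound only for numbers strictly above [M0]. *)
pose M := `|M0| + 1.
have fM p : `|f p| <= M.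
  by apply: fM0 => //; rewrite /M (le_lt_trans (ler_norm M0))// ltrDl.
have mf : measurable_fun setT f by exact: continuous_measurable_prod.
pose D h p := W h p * f (T h (S h p)) - V h p * f (S h p).
have DE h : (h0 <= h)%N -> \int[thermalized dot (beta h) (mu_ h)]_p f p -
    \int[thermalized dot (beta h) mu]_p f p = \int[(leb \x leb)%E]_p D h p.
  move=> h0h; rewrite [RHS]RintegralB//; last 2 first.
  - exact: (intU _ _ _ _ (mW h) (W0 h) (Wg _ h0h) (mTS h) mf fM).
  - exact: (intU _ _ _ _ (mV h) (V0 h) (Vg _ h0h) (mS h) mf fM).
  rewrite /Rintegral; congr (fine _ - fine _).
    exact: (integral_weighted_image (mW h) (W0 h) (mTS h) (tauW h) mf).
  exact: (integral_weighted_image (mV h) (V0 h) (mS h) (tauV h) mf).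
(* The shift by [h0] makes the domination from (vi) valid at every index. *)
rewrite -(cvg_shiftn h0).
rewrite (_ : [sequence _]_n = fun h => \int[(leb \x leb)%E]_p D (h + h0)%N p); last first.
  by apply/funext => h /=; rewrite DE// leq_addl.
have mD h : measurable_fun setT (D h).
  apply: measurable_funB; apply: measurable_funM => //.
    exact: (measurableT_comp mf (mTS h)).
  exact: (measurableT_comp mf (mS h)).
apply: (@fine_cvg _ _ _ _ (fun h => \int[leb \x leb]_p (D (h + h0)%N p)%:E)%E 0).
have [] := @dominated_convergence _ _ _ (leb \x leb)%E setT measurableT
  (fun h p => (D (h + h0)%N p)%:E) (cst 0%E) (fun p => M%:E * `|(g' p)%:E|)%E _ _ _ _ _.
- by move=> h; exact/measurable_EFinP.
- exact: measurable_cst.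
- apply: filterS2 LS hLhat => p LSp Lp _.
  (* The limit (ii) is taken along the sequence [lambda_], which diverges. *)
  have cL : L' (S h p) @[h --> \oo] --> Lhat ((Num.sqrt 2)^-1 *: p.1).
    rewrite (_ : (fun h => L' (S h p)) = fun h => L (S h p)).
      exact: (cvg_comp _ _ loo Lp).
    by apply/funext.
  have cwb : wb (eta h p) @[h --> \oo] --> wb p.2.
    exact: (cvg_comp _ _ (hetalim p) (@continuous_thermal_weight_bar _ _ dot beta0 p.2)).
  have cfT := cvg_comp _ _ (hTlim p) (cf _).
  have cfS := cvg_comp _ _ (@cvg_S _ _ _ p loo) (cf _).
  (* Both products have the same limit: the weights tend to [wb p.2] and the arguments of [f] to the
     same diagonal point. *)
  have cD : D h p @[h --> \oo] --> (0 : R).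
    have := cvgB (cvgM (cvgM cwb cL) cfT) (cvgM (cvgM (cvg_cst (wb p.2)) cL) cfS).
    by rewrite subrr; apply.
  apply: cvg_EFin; first exact: nearW.
  by move: cD; rewrite -(cvg_shiftn h0); apply.
- by apply: integrableZl => //; exact: integrable_abse.
(* The absolute value of [D h p] is at most [M * (W h p + V h p)], which [WVg] bounds by
   [M * g' p]. *)
- apply: filterS WVg => p WVp h _; rewrite !abse_EFin -EFinM lee_fin.
  have absM (u x : R) : 0 <= u -> `|x| <= M -> `|u * x| <= M * u.
    by move=> u0 xM; rewrite normrM (ger0_norm u0) mulrC ler_wpM2r.
  apply: le_trans (ler_normB _ _) _.
  apply: (le_trans (lerD (absM _ _ (W0 _ _) (fM _)) (absM _ _ (V0 _ _) (fM _)))).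
  rewrite -mulrDr ler_wpM2l//; first exact: le_trans (fM p).
  by apply: le_trans (ler_norm _); apply: WVp; rewrite leq_addl.
by move=> _ _; rewrite integral_cst// mul0e.
Qed.
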